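(* For any given integer $M$, there exist infinitely many finite transitive permutation groups $G$ on sets $\Omega$ such that $\rho(G/\Omega)>M$.
   Context: For a finite transitive permutation group $G\leqslant\mathrm{Sym}(\Omega)$ with point stabilizer $G_\omega$: a subset $S\subseteq G$ is intersecting if for all $x,y\in S$ the permutation $xy^{-1}$ fixes some point of $\Omega$, and $\rho(G/\Omega)=\dfrac{|S|}{|G_\omega|\sqrt{|\Omega|}}$ where $S$ is an intersecting subset of the maximum possible size. *)

(* Defs.v *)
From HB Require Import structures.
From mathcomp Require Import all_boot all_order all_algebra all_fingroup.
From mathcomp Require Import reals.
Set Implicit Arguments.
Unset Strict Implicit.
Unset Printing Implicit Defensive.
Import Order.TTheory GRing.Theory Num.Theory GroupScope.
Local Open Scope ring_scope.

(* In [{perm T}] the product [x * y] applies [x] first.  With the opposite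
   convention one gets the image of this notion under inversion, which preserves
   subsets of G and their sizes, so that [rho] does not depend on this choice. *)
Definition intersecting (T : finType) (G S : {set {perm T}}) : bool :=
  (S \subset G) &&
  [forall x in S, forall y in S, [exists w, (x * y^-1)%g w == w]].

Definition max_intersecting (T : finType) (G : {set {perm T}}) : nat :=
  \max_(S : {set {perm T}} | intersecting G S) #|S|.

(* The value is the same for all base points [w] when [G] is transitive. *)
Definition rho (R : realType) (T : finType) (G : {group {perm T}}) (w : T) : R :=
  (max_intersecting G)%:R / (#|'C_G[w | 'P]|%:R * Num.sqrt #|T|%:R).

Definition perm_isomorphic (T1 T2 : finType)
    (G1 : {group {perm T1}}) (G2 : {group {perm T2}}) : Prop :=
  exists (f : T1 -> T2) (phi : {morphism G1 >-> {perm T2}}),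
    [/\ bijective f, isom G1 G2 phi &
        forall g x, g \in G1 -> f (g x) = phi g (f x)].

(* Main.v *)
Require Import Defs.
From HB Require Import structures.
From mathcomp Require Import all_boot all_order all_algebra all_fingroup.
From mathcomp Require Import reals.
From mathcomp Require Import cyclic ring.
Set Implicit Arguments.
Unset Strict Implicit.
Unset Printing Implicit Defensive.
Import Order.TTheory GRing.Theory Num.Theory GroupScope.
Local Open Scope ring_scope.

(** It suffices to have one transitive group with [rho > 1].  Indeed let [G^n]
    act on [T^n] coordinatewise.  A tuple of permutations fixes a point of [T^n]
    as soon as each of its components fixes a point of [T], so [S^n] is
    intersecting when [S] is; the orders of the stabilizer and of the underlying
    set are raised to the power [n] too, hence [rho (G^n) >= (rho G)^n]
    ([rho_pow]).  Letting [n] grow makes [rho] arbitrarily large, and the degrees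
    [|T|^n] are distinct, so the groups are not isomorphic as permutation groups.

    For the initial group, suppose that [G] is transitive on [T] and has a
    subgroup [K] of index at most 3 all of whose elements fix a point.  Then [K]
    is intersecting, and as a point stabilizer has order [|G| / |T|],
    [rho G >= |K| sqrt |T| / |G| >= sqrt |T| / 3], which exceeds 1 when
    [|T| > 9].  Here [T] consists of the 18 affine planes
    [x_{i+1} + (-1)^s x_{i+2} = c] of [F_3^3] (indices modulo 3); [K] is the
    group of maps [x |-> eps x + v] where [eps] is a diagonal matrix of signs
    with determinant 1, and [G] is generated by [K] and the cyclic shift of the
    coordinates, which normalizes [K] and has order 3.

    Each element of [K] fixes one of the planes ([affine_fix]).  If [eps] is not
    the identity, it is [-1] on two coordinates and acts on the value of a form
    in these coordinates as [c |-> - c + b], which has a fixed point because 2 is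
    invertible.  If [eps = 1], the map is the translation by [v]; among the three
    coordinates of [v] two agree up to sign, since they take only the values 0
    and [+-1], so some form vanishes at [v] and its planes are preserved.  Thus
    [rho G >= sqrt 18 / 3 = sqrt 2] ([rho_plane]). *)

(** * Intersecting sets and the invariant [rho] *)

(** Agreement of [x] and [y] at a point is the symmetric form of the condition
    that [x * y^-1] has a fixed point; it passes to products coordinatewise. *)
Lemma intersectingP (T : finType) (G S : {set {perm T}}) :
  reflect (S \subset G /\ forall x y, x \in S -> y \in S -> exists w, x w = y w)
          (intersecting G S).
Proof.
apply: (iffP andP) => -[sSG agree]; split=> //.
  move=> x y Sx Sy.
  have /existsP[w /eqP] := forall_inP (forall_inP agree x Sx) y Sy.
  by rewrite permM => /(congr1 y); rewrite permKV => xyw; exists w.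
apply/forall_inP=> x Sx; apply/forall_inP=> y Sy.
by have [w xyw] := agree x y Sx Sy; apply/existsP; exists w; rewrite permM xyw permK.
Qed.

Lemma leq_max_intersecting (T : finType) (G S : {set {perm T}}) :
  intersecting G S -> (#|S| <= max_intersecting G)%N.
Proof. by move=> intS; rewrite /max_intersecting (bigD1 S) //= leq_maxl. Qed.

Lemma max_intersecting_attained (T : finType) (G : {set {perm T}}) :
  exists2 S, intersecting G S & max_intersecting G = #|S|.
Proof.
have int0 : intersecting G set0.
  by apply/intersectingP; split; [exact: sub0set | move=> x y; rewrite inE].
rewrite /max_intersecting (bigop.bigmax_eq_arg set0) //.
by case: arg_maxnP => // S intS _; exists S.
Qed.

Lemma subgroup_intersecting (T : finType) (G K : {group {perm T}}) :
  K \subset G -> (forall p, p \in K -> exists w, p w = w) -> intersecting G K.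
Proof.
move=> sKG fixK; apply/intersectingP; split=> // x y Kx Ky.
have [|w xyw] := fixK (x * y^-1)%g; first by rewrite groupM ?groupV.
by exists w; move/(congr1 y): xyw; rewrite permM permKV.
Qed.

(** In this form every factor of [rho] is multiplicative over products, and the
    point stabilizer need not be identified. *)
Lemma rho_transitive (R : realType) (T : finType) (G : {group {perm T}}) (w : T) :
  [transitive G, on [set: T] | 'P] ->
  rho R G w = (max_intersecting G)%:R * Num.sqrt #|T|%:R / #|G|%:R.
Proof.
move=> trG; rewrite /rho.
have T0 : (0 < #|T|)%N by apply/card_gt0P; exists w.
have sT0 : Num.sqrt #|T|%:R != 0 :> R by rewrite gt_eqF // sqrtr_gt0 ltr0n.
have C0 : #|'C_G[w | 'P]|%:R != 0 :> R by rewrite pnatr_eq0 -lt0n cardG_gt0.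
have -> : #|G|%:R = #|'C_G[w | 'P]|%:R * Num.sqrt #|T|%:R ^+ 2 :> R.
  rewrite sqr_sqrtr ?ler0n // -natrM -(card_orbit_stab 'P G w).
  by rewrite (atransP trG) ?inE // cardsT mulnC.
by field; rewrite sT0 C0.
Qed.

(** * Powers of a permutation group in product action *)

Section Power.
Variables (I T : finType).
Implicit Types (g h : {ffun I -> {perm T}}) (f : {ffun I -> T}).

Definition coordwise g f : {ffun I -> T} := [ffun i => g i (f i)].

Lemma coordwise_inj g : injective (coordwise g).
Proof.
move=> f1 f2 /ffunP eq_gf; apply/ffunP=> i.
by have := eq_gf i; rewrite !ffunE => /perm_inj.
Qed.

Definition perm_pow g : {perm {ffun I -> T}} := perm (@coordwise_inj g).

Lemma perm_powE g f i : perm_pow g f i = g i (f i).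
Proof. by rewrite permE ffunE. Qed.

Lemma perm_pow_inj : injective perm_pow.
Proof.
move=> g h eq_gh; apply/ffunP=> i; apply/permP=> t.
(* The components are recovered from the action on constant functions. *)
have := congr1 (fun p : {perm _} => p [ffun=> t] i) eq_gh.
by rewrite !perm_powE ffunE.
Qed.

Definition pow_set (A : {set {perm T}}) := [set perm_pow g | g in ffun_on (mem A)].

Lemma mem_pow_set (A : {set {perm T}}) g :
  (forall i, g i \in A) -> perm_pow g \in pow_set A.
Proof. by move=> Ag; apply: imset_f; apply/ffun_onP. Qed.

Lemma pow_setP (A : {set {perm T}}) p :
  reflect (exists2 g : {ffun I -> {perm T}}, forall i, g i \in A & p = perm_pow g)
          (p \in pow_set A).
Proof.
by apply: (iffP imsetP) => -[g Ag ->]; exists g => //; apply/ffun_onP.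
Qed.

Lemma card_pow_set (A : {set {perm T}}) : #|pow_set A| = (#|A| ^ #|I|)%N.
Proof. by rewrite (card_imset _ perm_pow_inj) card_ffun_on. Qed.

Lemma pow_group_set (G : {group {perm T}}) : group_set (pow_set G).
Proof.
apply/group_setP; split.
  suff -> : 1%g = perm_pow [ffun=> 1%g] by apply: mem_pow_set => i; rewrite ffunE.
  by apply/permP=> f; apply/ffunP=> i; rewrite perm_powE ffunE !perm1.
move=> _ _ /pow_setP[g Gg ->] /pow_setP[h Gh ->].
suff -> : (perm_pow g * perm_pow h)%g = perm_pow [ffun i => g i * h i]%g.
  by apply: mem_pow_set => i; rewrite ffunE groupM.
by apply/permP=> f; apply/ffunP=> i; rewrite permM !perm_powE ffunE permM.
Qed.
Canonical pow_group (G : {group {perm T}}) := Group (pow_group_set G).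

Lemma pow_transitive (G : {group {perm T}}) (t : T) :
  [transitive G, on [set: T] | 'P] ->
  [transitive pow_group G, on [set: {ffun I -> T}] | 'P].
Proof.
move=> trG; pose f0 : {ffun I -> T} := [ffun=> t].
apply/imsetP; exists f0; rewrite ?inE //; apply/esym/setP=> f; rewrite inE.
have /fin_all_exists[g gP] i : exists p, p \in G /\ p t = f i.
  by have [p Gp ->] := atransP2 trG (in_setT t) (in_setT (f i)); exists p.
apply/orbitP; exists (perm_pow (finfun g)).
  by apply: mem_pow_set => i; rewrite ffunE; case: (gP i).
by apply/ffunP=> i; rewrite /= /aperm perm_powE !ffunE; case: (gP i).
Qed.

Lemma pow_intersecting (G S : {set {perm T}}) :
  intersecting G S -> intersecting (pow_set G) (pow_set S).
Proof.
move=> /intersectingP[/subsetP sSG agree]; apply/intersectingP; split.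
  by apply/subsetP=> _ /pow_setP[g Sg ->]; apply: mem_pow_set => i; apply: sSG.
move=> _ _ /pow_setP[g Sg ->] /pow_setP[h Sh ->].
have /fin_all_exists[w gh_w] i := agree _ _ (Sg i) (Sh i).
by exists (finfun w); apply/ffunP=> i; rewrite !perm_powE ffunE.
Qed.

(** The tuples with entries in an optimal intersecting set of [G] form an
    intersecting set of the power; this gives only an inequality, as the power
    may have larger intersecting sets that are not of product form. *)
Lemma rho_pow (R : realType) (G : {group {perm T}}) (t : T) (w : {ffun I -> T}) :
  [transitive G, on [set: T] | 'P] -> rho R G t ^+ #|I| <= rho R (pow_group G) w.
Proof.
move=> trG; rewrite !rho_transitive //; last exact: pow_transitive.
have [S intS ->] := max_intersecting_attained G.
rewrite card_ffun card_pow_set !expr_div_n !natrX exprMn.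
have -> : Num.sqrt (#|T|%:R ^+ #|I|) = Num.sqrt #|T|%:R ^+ #|I| :> R.
  by elim: #|I| => [|n IHn]; rewrite ?expr0 ?sqrtr1 // !exprS sqrtrM ?ler0n // IHn.
rewrite ler_wpM2r ?invr_ge0 ?exprn_ge0 ?ler0n //.
rewrite ler_wpM2r ?exprn_ge0 ?sqrtr_ge0 //.
by rewrite -natrX ler_nat -card_pow_set leq_max_intersecting ?pow_intersecting.
Qed.

End Power.

(** * Affine maps of [F_3^3] acting on 18 planes *)

Lemma Z3_mul3 (x : 'Z_3) : x + x + x = 0.
Proof. by apply/val_inj; case: x => -[|[|[|]]]. Qed.

(** The triple [(i, s, c)] encodes the plane [form i s x = c] of [F_3^3].
    Coordinates are indexed by ['Z_3] so that index arithmetic is cyclic and all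
    axes are treated at once. *)
Definition plane : finType := ('Z_3 * bool * 'Z_3)%type.

Definition form (i : 'Z_3) (s : bool) (v : {ffun 'Z_3 -> 'Z_3}) : 'Z_3 :=
  v (i + 1) + (-1) ^+ s * v (i + 2).

(** A function [e] encodes the diagonal matrix with entries [(-1) ^+ e i].  The
    equation says, symmetrically in the three indices, that its determinant
    is 1. *)
Definition even_signs (e : {ffun 'Z_3 -> bool}) : Prop :=
  forall i, e (i + 2) = e i (+) e (i + 1).

(** The image of a plane under [x |-> eps x + v].  When the determinant of [eps]
    is 1, the sign in front of the second coordinate of the form changes by the
    product of the signs at [i + 1] and [i + 2], which is the sign at [i]. *)
Definition affine (e : {ffun 'Z_3 -> bool}) (v : {ffun 'Z_3 -> 'Z_3})
    (P : plane) : plane :=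
  let: (i, s, c) := P in
  (i, s (+) e i, (-1) ^+ e (i + 1) * c + form i (s (+) e i) v).

Lemma affine_inj e v : injective (affine e v).
Proof.
move=> [[i s] c] [[i' s'] c'] /eqP.
rewrite /affine !xpair_eqE => /andP[/andP[/eqP<- /eqP eqs] /eqP].
by rewrite eqs (addIb eqs) => /addIr /(can_inj (signrMK _)) ->.
Qed.

(** Composition of affine maps: the map [x |-> eps' (eps x + v) + v'] has linear
    part [eps' eps] and translation part [eps' v + v'].  Evenness of [e'] enters
    in the identity of [form i (s (+) e' i) (eps' v)] and
    [(-1) ^+ e' (i + 1) * form i s v]. *)
Lemma affine_comp e v e' v' (P : plane) : even_signs e' ->
  affine e' v' (affine e v P) =
  affine [ffun i => e i (+) e' i] [ffun i => (-1) ^+ e' i * v i + v' i] P.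
Proof.
case: P => [[i s] c] e'P; rewrite /affine !ffunE addbA; congr (_, _, _).
rewrite /form !ffunE !e'P !signr_addb.
(* The square of a sign is 1: [ring] needs this as a rewriting rule. *)
have := signrMK (e' i) (1 : 'Z_3); rewrite mulr1 => sq_e'i.
ring: sq_e'i.
Qed.

Lemma Z3_cycle (i : 'Z_3) :
  (i + 1 + 1 = i + 2) * (i + 1 + 2 = i) * (i + 2 + 1 = i) * (i + 2 + 2 = i + 1).
Proof.
split; [split; [split|]|]; first by ring.
all: by rewrite -[RHS]addr0 -(Z3_mul3 1); ring.
Qed.

(** The nonzero elements of [F_3] are [1] and [-1], so an element is determined
    up to sign by whether it vanishes. *)
Lemma add_signed_eq0 (x y : 'Z_3) :
  (x == 0) = (y == 0) -> exists s : bool, x + (-1) ^+ s * y = 0.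
Proof.
case: (x =P y) => [-> _|/eqP neq_xy eq0].
  by exists true; rewrite expr1 mulN1r subrr.
exists false; rewrite expr0 mul1r; apply/val_inj.
by case: x y neq_xy eq0 => [[|[|[|]]] //= ?] [[|[|[|]]] //= ?].
Qed.

(** Pigeonhole: of the three coordinates of [v], two agree up to sign. *)
Lemma form_eq0 v : exists i s, form i s v = 0.
Proof.
suff [i /add_signed_eq0[s vs]] : exists i, (v (i + 1) == 0) = (v (i + 2) == 0).
  by exists i, s.
have [v01|v01] := eqVneq (v 0 == 0) (v (0 + 1) == 0).
  by exists (0 + 2); rewrite !Z3_cycle.
have [v12|v12] := eqVneq (v (0 + 1) == 0) (v (0 + 2) == 0); first by exists 0.
exists (0 + 1); rewrite !Z3_cycle.
by case: (v 0 == 0) (v (0 + 1) == 0) (v (0 + 2) == 0) v01 v12 => [] [] [].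
Qed.

(** A nontrivial even sign vector has exactly one positive entry, and the entry
    that follows it is negative. *)
Lemma even_signs_descent e i :
  even_signs e -> e i -> exists2 j, e j = false & e (j + 1).
Proof.
move=> eP ei; case ei1: (e (i + 1)); have := eP i; rewrite ei ei1 /= => ei2.
  by exists (i + 2); rewrite ?Z3_cycle.
by exists (i + 1); rewrite ?Z3_cycle.
Qed.

(** Either two signs are [-1], and the values of a form in these two coordinates
    undergo a reflection, which has a fixed point; or the map is a translation,
    and it lies in the direction of one of the planes. *)
Lemma affine_fix e v : even_signs e -> exists P, affine e v P = P.
Proof.
move=> eP; have [i ei|e0] := pickP e.
  have [j ej ej1] := even_signs_descent eP ei.
  (* The fixed point of [c |-> - c + b] is [b / 2], and [1 / 2 = - 1] in [F_3]. *)
  exists (j, false, - form j false v); rewrite /affine ej ej1; congr (_, _, _).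
  by apply/eqP; rewrite expr1 mulN1r opprK -addr_eq0 Z3_mul3.
have [i [s v0]] := form_eq0 v.
by exists (i, s, 0); rewrite /affine !e0 addbF v0 mulr0 addr0.
Qed.

(** * The permutation group of degree 18 *)

Definition affine_perm e v : {perm plane} := perm (@affine_inj e v).

Definition affine_set : {set {perm plane}} :=
  [set p | [exists e : {ffun 'Z_3 -> bool}, exists v,
              [forall i, e (i + 2) == e i (+) e (i + 1)] && (p == affine_perm e v)]].

Lemma affine_setP p :
  reflect (exists e v, even_signs e /\ p = affine_perm e v) (p \in affine_set).
Proof.
rewrite inE; apply: (iffP existsP) => -[e].
  case/existsP=> v /andP[/forallP eP /eqP->].
  by exists e, v; split=> // i; apply/eqP.
case=> v [eP ->]; exists e; apply/existsP; exists v; rewrite eqxx andbT.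
by apply/forallP=> i; apply/eqP.
Qed.

Lemma affine_group_set : group_set affine_set.
Proof.
apply/group_setP; split.
  apply/affine_setP; exists [ffun=> false], [ffun=> 0]; split=> [i|].
    by rewrite !ffunE.
  apply/permP=> -[[i s] c]; rewrite perm1 permE /affine /form !ffunE /= addbF.
  by rewrite expr0 mul1r mulr0 !addr0.
move=> _ _ /affine_setP[e [v [eP ->]]] /affine_setP[e' [v' [e'P ->]]].
apply/affine_setP.
exists [ffun i => e i (+) e' i], [ffun i => (-1) ^+ e' i * v i + v' i].
split=> [i|]; first by rewrite !ffunE eP e'P addbACA.
by apply/permP=> P; rewrite permM !permE affine_comp.
Qed.
Canonical affine_group := Group affine_group_set.

Definition shift_plane (P : plane) : plane :=
  let: (i, s, c) := P in (i + 1, s, c).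

Lemma shift_plane_inj : injective shift_plane.
Proof.
move=> [[i s] c] [[i' s'] c'] /eqP; rewrite /shift_plane !xpair_eqE.
by case/andP=> /andP[/eqP/addIr-> /eqP->] /eqP->.
Qed.

(** The action on planes of the cyclic permutation of the coordinates. *)
Definition shift : {perm plane} := perm shift_plane_inj.

Lemma shiftX n i s c : (shift ^+ n)%g (i, s, c) = (i + n%:R, s, c).
Proof.
elim: n => [|n IHn]; first by rewrite expg0 perm1 addr0.
by rewrite expgSr permM IHn permE mulrSr addrA.
Qed.

Lemma shift_order : (#[shift] %| 3)%N.
Proof.
rewrite order_dvdn; apply/eqP/permP=> -[[i s] c].
by rewrite shiftX perm1 !mulrSr mulr0n add0r Z3_mul3 addr0.
Qed.

(** Conjugation by the shift rotates both the signs and the translation vector;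
    the index [i + 2] stands for [i - 1]. *)
Lemma shift_norm : shift \in 'N(affine_group).
Proof.
apply/normP/eqP; rewrite eqEcard cardJg leqnn andbT; apply/subsetP=> p.
rewrite mem_conjg => /affine_setP[e [v [eP def_p]]].
apply/affine_setP; exists [ffun i => e (i + 2)], [ffun i => v (i + 2)].
split=> [i|].
  by rewrite !ffunE addrAC eP addrAC.
rewrite -[p](conjgKV shift) def_p conjgE.
apply/permP=> P; rewrite -[P](permKV shift); move: (shift^-1 P)%g => {P} -[[i s] c].
rewrite !permM permK !permE /affine /shift_plane /form !ffunE.
by rewrite !Z3_cycle.
Qed.

Definition plane_group : {group {perm plane}} := affine_group <*> <[shift]>.

Lemma card_plane_group : (#|plane_group| <= 3 * #|affine_group|)%N.
Proof.
rewrite /= norm_joinEr ?cycle_subG ?shift_norm //.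
apply: leq_trans (leq_pmulr _ (cardG_gt0 (affine_group :&: <[shift]>))) _.
by rewrite -mul_cardG mulnC leq_mul2r dvdn_leq ?shift_order ?orbT.
Qed.

Lemma plane_transitive : [transitive plane_group, on [set: plane] | 'P].
Proof.
have sub p : p \in affine_group -> p \in plane_group by apply/subsetP/joing_subl.
have shG : shift \in plane_group by rewrite -cycle_subG joing_subr.
apply/imsetP; exists (0, false, 0); rewrite ?inE //.
apply/esym/setP=> -[[i s] c]; rewrite inE.
(* This affine map sends the plane [x_1 + x_2 = 0] to [x_1 + (-1)^s x_2 = c];
   the shift then brings the axis 0 to [i]. *)
pose e := [ffun j : 'Z_3 => s && (j != 1)].
pose v := [ffun j : 'Z_3 => c *+ (j == 1)].
have eP : even_signs e.
  by move=> [[|[|[|]]] // lt_j3]; rewrite !ffunE; case: (s).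
apply/orbitP; exists (affine_perm e v * shift ^+ i)%g.
  by rewrite groupM ?groupX // sub //; apply/affine_setP; exists e, v.
rewrite /= /aperm permM permE /affine shiftX natr_Zp !add0r mulr0 add0r /form.
by rewrite !ffunE !add0r eqxx mulr1n mulr0n mulr0 addr0 andbT.
Qed.

Lemma card_plane : #|plane| = 18%N.
Proof. by rewrite !card_prod card_bool !card_ord. Qed.

(** Since the affine maps have index at most 3, [rho] is at least [sqrt 18 / 3]. *)
Lemma rho_plane (R : realType) (P : plane) : Num.sqrt 2 <= rho R plane_group P.
Proof.
rewrite rho_transitive ?plane_transitive // card_plane.
have intK : intersecting plane_group affine_group.
  apply: subgroup_intersecting; first exact: joing_subl.
  move=> _ /affine_setP[e [v [eP ->]]].
  by have [w w_fix] := affine_fix v eP; exists w; rewrite permE.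
have -> : 18%:R = 3 ^+ 2 * 2 :> R by ring.
rewrite sqrtrM ?sqr_ge0 // sqrtr_sqr ger0_norm //.
rewrite ler_pdivlMr ?ltr0n ?cardG_gt0 //.
rewrite mulrC mulrA ler_wpM2r ?sqrtr_ge0 // -natrM ler_nat mulnC.
by rewrite (leq_trans card_plane_group) // leq_mul2l leq_max_intersecting ?orbT.
Qed.

(* [transitive G, on setT | 'P] forces the underlying set to be nonempty, so the
   quantification over base points [w] is not vacuous. *)
Theorem theorem1p6 (R : realType) (M : int) :
  exists (Omega : nat -> finType) (G : forall k, {group {perm (Omega k)}}),
    [/\ forall k, [transitive G k, on [set: Omega k] | 'P],
        forall k (w : Omega k), (M%:~R < rho R (G k) w)%R &
        forall j k, j != k -> ~ perm_isomorphic (G j) (G k)].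
Proof.
(* An even exponent makes the power of [sqrt 2] an integer: [2 ^ m k > M]. *)
pose m k := (`|M| + k)%N.
exists (fun k => {ffun 'I_(2 * m k) -> plane}), (fun k => pow_group _ plane_group).
split=> [k|k w|j k neq_jk [f [phi [/bij_eq_card]]]].
- exact: pow_transitive (0, false, 0) plane_transitive.
- have sqrt2_le := rho_plane R (0, false, 0).
  apply: lt_le_trans (rho_pow R (0, false, 0) w plane_transitive).
  apply: (@lt_le_trans _ _ (Num.sqrt 2 ^+ (2 * m k))); last first.
    rewrite card_ord; apply: lerXn2r; rewrite ?nnegrE ?sqrtr_ge0 //.
    exact: le_trans (sqrtr_ge0 _) sqrt2_le.
  have leM : M%:~R <= (m k)%:R :> R.
    rewrite [(m k)%:R]pmulrn ler_int (le_trans (ler_norm M)) //.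
    by rewrite -abszE lez_nat leq_addr.
  rewrite exprM sqr_sqrtr ?ler0n // -natrX (le_lt_trans leM) // ltr_nat.
  exact: ltn_expl.
rewrite !card_ffun !card_ord card_plane => /eqP.
by rewrite eqn_exp2l // eqn_mul2l /= eqn_add2l (negbTE neq_jk).
Qed.
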